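(* Let $H$ be a Hopf algebra over a field $\Bbbk$. Algebraic partial $H$-comodules admit a globalization: for every algebraic partial $H$-comodule $(M,\partial_M)$, the associated geometric partial $H$-comodule $(M,M\bullet H,\pi_M,\rho_M)$ in $\mathsf{Vect}_\Bbbk$ is globalizable.
   Context: Let $(H,\mu,u,\Delta,\varepsilon,S)$ be the Hopf algebra. An algebraic partial (right) $H$-comodule is a vector space $M$ with a linear map $\partial_M:M\to M\otimes H$ satisfying: (1) $(M\otimes\varepsilon)\circ\partial_M=\mathrm{Id}_M$; (2) $(M\otimes H\otimes\mu)(M\otimes H\otimes S\otimes H)(M\otimes\Delta\otimes H)(\partial_M\otimes H)\partial_M=(M\otimes H\otimes\mu)(M\otimes H\otimes S\otimes H)(\partial_M\otimes H\otimes H)(\partial_M\otimes H)\partial_M$; (3) $(M\otimes\mu\otimes H)(M\otimes S\otimes H\otimes H)(M\otimes H\otimes\Delta)(\partial_M\otimes H)\partial_M=(M\otimes\mu\otimes H)(M\otimes S\otimes H\otimes H)(\partial_M\otimes H\otimes H)(\partial_M\otimes H)\partial_M$. The associated geometric partial comodule: fix bases $\{h_i\}_{i\in I}$ of $H$ and $\{m_\ell\}_{\ell\in L}$ of $M$, write $\Delta(h_i)=\sum_{j,k}a^i_{j,k}h_j\otimes h_k$ and $\partial_M(m_\ell)=\sum_{p,i}b^\ell_{p,i}m_p\otimes h_i$; let $Q\subset M\otimes H$ be the subspace generated by $\sum_{q,p,k}b^\ell_{p,t}b^p_{q,k}m_q\otimes h_k-\sum_{q,p,k}b^\ell_{q,p}a^p_{k,t}m_q\otimes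 h_k$ for $\ell\in L$, $t\in I$; put $M\bullet H=(M\otimes H)/Q$, $\pi_M:M\otimes H\to M\bullet H$ the projection, $\rho_M=\pi_M\circ\partial_M$. A geometric partial comodule $(X,X\bullet H,\pi_X,\rho_X)$ is globalizable if there is a (global, coassociative counital) right $H$-comodule $(Y,\delta)$ with a linear map $p:Y\to X$ such that: (GL1) $\rho_X\circ p=\pi_X\circ(p\otimes H)\circ\delta$; (GL2) for every right $H$-comodule $(Z,\delta_Z)$, $\eta\mapsto p\circ\eta$ is a bijection from $H$-colinear maps $Z\to Y$ onto linear maps $f:Z\to X$ with $\rho_X\circ f=\pi_X\circ(f\otimes H)\circ\delta_Z$; (GL3) $(X\bullet H,\rho_X,\pi_X)$ is the pushout in $\mathsf{Vect}_\Bbbk$ of $p:Y\to X$ and $(p\otimes H)\circ\delta:Y\to X\otimes H$. Such $(Y,\delta,p)$ is called a globalization. *)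

(* Defs.v *)
From HB Require Import structures.
From mathcomp Require Import all_boot all_algebra.
From mathcomp Require Import finmap generic_quotient ring_quotient.
From mathcomp Require Import sesquilinear boolp classical_sets.
From mathcomp.multinomials Require Import monalg.

Set Implicit Arguments.
Unset Strict Implicit.
Unset Printing Implicit Defensive.

Import GRing.Theory.
Local Open Scope ring_scope.
Local Open Scope classical_set_scope.

Section LinearCombinations.
Variables (k : fieldType) (V : lmodType k) (I : choiceType) (e : I -> V).

Definition lincomb (c : {malg k[I]}) : V := \sum_(i <- msupp c) c@_i *: e i.

Lemma lincombEw (c : {malg k[I]}) (s : {fset I}) :
  (msupp c `<=` s)%fset -> lincomb c = \sum_(i <- s) c@_i *: e i.
Proof.
move=> le_cs; rewrite /lincomb; apply: big_fset_incl => // i _ iNc.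
by rewrite mcoeff_outdom // scale0r.
Qed.

Lemma lincomb_is_linear : linear lincomb.
Proof.
move=> x c d; pose s := (msupp c `|` msupp d `|` msupp (x *: c + d))%fset.
have sc : (msupp c `<=` s)%fset by rewrite /s -fsetUA fsubsetUl.
have sd : (msupp d `<=` s)%fset.
  by rewrite /s fsetUAC fsubsetUr.
rewrite (lincombEw sc) (lincombEw sd) (@lincombEw _ s) ?fsubsetUr //.
rewrite scaler_sumr -big_split /=; apply: eq_bigr => i _.
by rewrite mcoeffD mcoeffZ scalerDl scalerA.
Qed.

HB.instance Definition _ :=
  GRing.isLinear.Build k {malg k[I]} V _ lincomb lincomb_is_linear.

Lemma lincombU (i : I) : lincomb << i >> = e i.
Proof. by rewrite /lincomb msuppU oner_eq0 big_seq_fset1 mcoeffUU scale1r. Qed.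

Definition is_basis : Prop :=
  forall v : V, exists! c : {malg k[I]}, v = lincomb c.

End LinearCombinations.

Section Span.
Variables (k : fieldType) (V : lmodType k) (G : set V).

Definition span : {pred V} := fun v =>
  `[< exists n (c : 'I_n -> k) (g : 'I_n -> V),
        (forall i, G (g i)) /\ v = \sum_(i < n) c i *: g i >].

Lemma span_submod_closed : submod_closed span.
Proof.
split; first by apply/asboolP; exists 0%N, (fun=> 0), (fun=> 0);
  split=> [[]|] //; rewrite big_ord0.
move=> x _ _ /asboolP[n [c [g [Gg ->]]]] /asboolP[m [d [f [Gf ->]]]].
apply/asboolP; exists (n + m)%N.
exists (fun i => match split i with inl j => x * c j | inr j => d j end).
exists (fun i => match split i with inl j => g j | inr j => f j end).
split=> [i|]; first by case: (split i).
rewrite big_split_ord /= scaler_sumr; congr (_ + _); apply: eq_bigr => i _.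
  by rewrite (unsplitK (inl i)) scalerA.
by rewrite (unsplitK (inr i)).
Qed.

HB.instance Definition _ :=
  GRing.isSubmodClosed.Build k V span span_submod_closed.

Lemma span_oppr_closed : oppr_closed span.
Proof. by move=> v Gv; rewrite -scaleN1r rpredZ. Qed.

HB.instance Definition _ := GRing.isOppClosed.Build V span span_oppr_closed.

Lemma mem_span (v : V) : G v -> v \in span.
Proof.
move=> Gv; apply/asboolP; exists 1%N, (fun=> 1), (fun=> v).
by split=> //; rewrite big_ord1 scale1r.
Qed.

End Span.

Section QuotientSpace.
Local Open Scope quotient_scope.
Variables (k : fieldType) (V : lmodType k) (G : set V).

(* V modulo the subspace spanned by G *)
Definition quotmod : Type := Quotient.quot (span G).
HB.instance Definition _ := GRing.Zmodule.on quotmod.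

Definition qproj (v : V) : quotmod := \pi_(Quotient.quot (span G)) v.

Lemma qproj_eq (u v : V) : (qproj u = qproj v) <-> (u - v \in span G).
Proof. by rewrite Quotient.idealrBE; split=> /eqP. Qed.

Lemma qproj_repr (q : quotmod) : qproj (repr q) = q.
Proof. exact: reprK. Qed.

Lemma qproj_zmod : zmod_morphism qproj.
Proof. by move=> u v; rewrite /qproj raddfB. Qed.

Definition qscale (c : k) (q : quotmod) : quotmod := qproj (c *: repr q).

Lemma qscale_proj c v : qscale c (qproj v) = qproj (c *: v).
Proof.
apply/qproj_eq; rewrite -scalerBr; apply: rpredZ.
by apply/qproj_eq; rewrite qproj_repr.
Qed.

Lemma qscaleA a b v : qscale a (qscale b v) = qscale (a * b) v.
Proof. by rewrite -[v]qproj_repr !qscale_proj scalerA. Qed.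
Lemma qscale1 : left_id 1 qscale.
Proof. by move=> v; rewrite /qscale scale1r qproj_repr. Qed.
Lemma qprojD u v : qproj (u + v) = qproj u + qproj v.
Proof. by rewrite /qproj raddfD. Qed.
Lemma qscaleDr : right_distributive qscale +%R.
Proof.
move=> c u v; rewrite -[u]qproj_repr -[v]qproj_repr.
by rewrite -qprojD !qscale_proj scalerDr qprojD.
Qed.
Lemma qscaleDl v : {morph qscale^~ v : a b / a + b}.
Proof. by move=> a b; rewrite /qscale scalerDl qprojD. Qed.

HB.instance Definition _ := GRing.Zmodule_isLmodule.Build k quotmod
  qscaleA qscale1 qscaleDr qscaleDl.

Lemma qproj_is_linear : linear qproj.
Proof. by move=> c u v; rewrite qprojD -qscale_proj. Qed.

HB.instance Definition _ :=
  GRing.isLinear.Build k V quotmod _ qproj qproj_is_linear.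

Lemma qproj_surj (q : quotmod) : exists v, qproj v = q.
Proof. by exists (repr q); rewrite qproj_repr. Qed.

End QuotientSpace.

(* The tensor product of two vector spaces, by its universal property.        *)
Record tensor_product (k : fieldType) (A B : lmodType k) := TensorProduct {
  tp_space : lmodType k;
  tp_tens : {bilinear A -> B -> tp_space};
  tp_lift : forall C : lmodType k,
    {bilinear A -> B -> C} -> {linear tp_space -> C};
  tp_liftE : forall (C : lmodType k) (f : {bilinear A -> B -> C}) a b,
    tp_lift f (tp_tens a b) = f a b;
  tp_ext : forall (C : lmodType k) (f g : {linear tp_space -> C}),
    (forall a b, f (tp_tens a b) = g (tp_tens a b)) -> f =1 g
}.

(* It exists: take the free vector space on A * B modulo the subspace spanned *)
(* by the bilinearity relations.                                              *)
Section TensorConstruction.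
Variables (k : fieldType) (A B : lmodType k).

Let free_pair (a : A) (b : B) : {malg k[(A * B)%type]} := << (a, b) >>.

Let bilinearity : set {malg k[(A * B)%type]} :=
  [set w | (exists c a a' b, w = free_pair (c *: a + a') b
                             - (c *: free_pair a b + free_pair a' b)) \/
           (exists c a b b', w = free_pair a (c *: b + b')
                             - (c *: free_pair a b + free_pair a b'))].

Let T := quotmod bilinearity.
Let tn (a : A) (b : B) : T := qproj _ (free_pair a b).

Let tn_bilinear : bilinear_for *:%R *:%R tn.
Proof.
split=> [b c a a'|a c b b'] /=; rewrite /tn.
  rewrite -linearP; apply/qproj_eq/mem_span.
  by left; exists c, a, a', b.
rewrite -linearP; apply/qproj_eq/mem_span.
by right; exists c, a, b, b'.
Qed.
HB.instance Definition _ := bilinear_isBilinear.Build k A B T _ _ tn tn_bilinear.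

Section Lift.
Variables (C : lmodType k) (f : {bilinear A -> B -> C}).

Let lift (t : T) : C := lincomb (fun ab => f ab.1 ab.2) (repr t).

Let lift_proj w : lift (qproj _ w) = lincomb (fun ab => f ab.1 ab.2) w.
Proof.
apply/eqP; rewrite -subr_eq0 /lift -linearB /=.
have /asboolP[n [c [g [Gg ->]]]] : repr (qproj bilinearity w) - w
    \in span bilinearity by apply/qproj_eq; rewrite qproj_repr.
rewrite linear_sum big1 //= => i _; rewrite linearZ /=.
case: (Gg i) => [[d [a [a' [b ->]]]]|[d [a [b [b' ->]]]]].
  by rewrite linearB linearP /= !lincombU /= linearPl subrr scaler0.
by rewrite linearB linearP /= !lincombU /= linearPr subrr scaler0.
Qed.

Let lift_linear : linear lift.
Proof.
move=> c s t; have [u <-] := qproj_surj s; have [v <-] := qproj_surj t.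
by rewrite -linearP !lift_proj linearP.
Qed.
HB.instance Definition _ := GRing.isLinear.Build k T C _ lift lift_linear.

Definition raw_lift : {linear T -> C} := lift.

Lemma raw_liftE a b : raw_lift (tn a b) = f a b.
Proof. by rewrite /raw_lift /= lift_proj lincombU. Qed.
End Lift.

Let raw_ext (C : lmodType k) (f g : {linear T -> C}) :
  (forall a b, f (tn a b) = g (tn a b)) -> f =1 g.
Proof.
move=> fg t; have [w <-] := qproj_surj t; rewrite (monalgE w) !linear_sum /=.
apply: eq_bigr => -[a b] _.
have -> : << w@_(a, b) *g (a, b) >> = w@_(a, b) *: free_pair a b.
  by apply/malgP => x; rewrite mcoeffZ !mcoeffU mulr_natr.
by rewrite !linearZ /=; congr (_ *: _); exact: fg.
Qed.

(* Opaque: only the universal property is used afterwards.                    *)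
Definition tensor_product_of : tensor_product A B.
Proof. exact: (@TensorProduct k A B T tn raw_lift raw_liftE raw_ext). Qed.

End TensorConstruction.

Section TensorProduct.
Variables (k : fieldType) (A B : lmodType k).

Definition tensor : lmodType k := tp_space (tensor_product_of A B).
Definition tens : {bilinear A -> B -> tensor} := tp_tens _.
Definition tlift (C : lmodType k) (f : {bilinear A -> B -> C}) :
  {linear tensor -> C} := tp_lift _ f.

Lemma tliftE (C : lmodType k) (f : {bilinear A -> B -> C}) a b :
  tlift f (tens a b) = f a b.
Proof. exact: tp_liftE. Qed.

Lemma tens_ext (C : lmodType k) (f g : {linear tensor -> C}) :
  (forall a b, f (tens a b) = g (tens a b)) -> f =1 g.
Proof. exact: tp_ext. Qed.

Lemma tlift_lin (C : lmodType k) (f g h : {bilinear A -> B -> C}) (c : k) t :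
  (forall a b, h a b = c *: f a b + g a b) ->
  tlift h t = c *: tlift f t + tlift g t.
Proof.
move=> hE; rewrite (@tens_ext _ (tlift h) ((c \*: tlift f) \+ tlift g)) //.
by move=> a b /=; rewrite !tliftE.
Qed.

End TensorProduct.

Arguments tens {k A B}.
Notation "A \ot B" := (tensor A B) (at level 40, left associativity).

Section TensorMaps.
Variable k : fieldType.
Implicit Types A B C D : lmodType k.

Section Map.
Variables (A B C D : lmodType k) (f : {linear A -> C}) (g : {linear B -> D}).
Let tm (a : A) (b : B) : C \ot D := tens (f a) (g b).
Let tm_bilinear : bilinear_for *:%R *:%R tm.
Proof.
by split=> [b c a a'|a c b b'] /=; rewrite /tm linearP ?linearPl ?linearPr.
Qed.
HB.instance Definition _ :=
  bilinear_isBilinear.Build k A B (C \ot D) _ _ tm tm_bilinear.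

Definition tmap : {linear A \ot B -> C \ot D} := tlift tm.

Lemma tmapE a b : tmap (tens a b) = tens (f a) (g b).
Proof. exact: tliftE. Qed.
End Map.

Section Flip.
Variables (A B : lmodType k).
Let tf (a : A) (b : B) : B \ot A := tens b a.
Let tf_bilinear : bilinear_for *:%R *:%R tf.
Proof.
by split=> [b c a a'|a c b b'] /=; rewrite /tf ?linearPl ?linearPr.
Qed.
HB.instance Definition _ :=
  bilinear_isBilinear.Build k A B (B \ot A) _ _ tf tf_bilinear.

Definition tflip : {linear A \ot B -> B \ot A} := tlift tf.

Lemma tflipE a b : tflip (tens a b) = tens b a.
Proof. exact: tliftE. Qed.
End Flip.

Section Assoc.
Variables (A B C : lmodType k).

Let ar_in (c : C) (a : A) (b : B) : A \ot (B \ot C) := tens a (tens b c).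
Let ar_in_bilinear c : bilinear_for *:%R *:%R (ar_in c).
Proof.
by split=> [b x a a'|a x b b'] /=; rewrite /ar_in ?linearPl ?linearPr.
Qed.
HB.instance Definition _ c :=
  bilinear_isBilinear.Build k A B (A \ot (B \ot C)) _ _ (ar_in c)
    (ar_in_bilinear c).

Let ar (t : A \ot B) (c : C) : A \ot (B \ot C) := tlift (ar_in c) t.
Let ar_bilinear : bilinear_for *:%R *:%R ar.
Proof.
split=> [c x t t'|t x c c'] /=; rewrite /ar; first exact: linearP.
by apply: tlift_lin => a b; rewrite /= /ar_in !linearPr.
Qed.
HB.instance Definition _ :=
  bilinear_isBilinear.Build k (A \ot B) C (A \ot (B \ot C)) _ _ ar ar_bilinear.

Definition tassocr : {linear A \ot B \ot C -> A \ot (B \ot C)} := tlift ar.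

Lemma tassocrE a b c :
  tassocr (tens (tens a b) c) = tens a (tens b c).
Proof. by rewrite /tassocr tliftE /= /ar tliftE. Qed.

Let al_in (a : A) (b : B) (c : C) : A \ot B \ot C := tens (tens a b) c.
Let al_in_bilinear a : bilinear_for *:%R *:%R (al_in a).
Proof.
by split=> [c x b b'|b x c c'] /=; rewrite /al_in ?linearPr ?linearPl.
Qed.
HB.instance Definition _ a :=
  bilinear_isBilinear.Build k B C (A \ot B \ot C) _ _ (al_in a)
    (al_in_bilinear a).

Let al (a : A) (t : B \ot C) : A \ot B \ot C := tlift (al_in a) t.
Let al_bilinear : bilinear_for *:%R *:%R al.
Proof.
split=> [t x a a'|a x t t'] /=; rewrite /al; last exact: linearP.
by apply: tlift_lin => b c; rewrite /= /al_in !linearPl.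
Qed.
HB.instance Definition _ :=
  bilinear_isBilinear.Build k A (B \ot C) (A \ot B \ot C) _ _ al al_bilinear.

Definition tassocl : {linear A \ot (B \ot C) -> A \ot B \ot C} := tlift al.

Lemma tassoclE a b c :
  tassocl (tens a (tens b c)) = tens (tens a b) c.
Proof. by rewrite /tassocl tliftE /= /al tliftE. Qed.
End Assoc.

Section Unit.
Variable A : lmodType k.
Let ru (a : A) (c : k^o) : A := c *: a.
Let ru_bilinear : bilinear_for *:%R *:%R ru.
Proof.
split=> [c x a a'|a x c c'] /=; rewrite /ru.
  by rewrite scalerDr !scalerA mulrC.
by rewrite scalerDl scalerA.
Qed.
HB.instance Definition _ := bilinear_isBilinear.Build k A k^o A _ _ ru ru_bilinear.

Definition tunitr : {linear A \ot k^o -> A} := tlift ru.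

Lemma tunitrE a c : tunitr (tens a c) = c *: a.
Proof. exact: tliftE. Qed.

Definition tunitl : {linear k^o \ot A -> A} := tunitr \o tflip k^o A.

Lemma tunitlE c a : tunitl (tens c a) = c *: a.
Proof. by rewrite /tunitl /= tflipE tunitrE. Qed.
End Unit.

Section Mul.
Variable H : algType k.
Let mu (x y : H) : H := x * y.
Let mu_bilinear : bilinear_for *:%R *:%R mu.
Proof.
split=> [c x a a'|a x c c'] /=; rewrite /mu.
  by rewrite mulrDl scalerAl.
by rewrite mulrDr scalerAr.
Qed.
HB.instance Definition _ := bilinear_isBilinear.Build k H H H _ _ mu mu_bilinear.

Definition tmul : {linear H \ot H -> H} := tlift mu.

Lemma tmulE x y : tmul (tens x y) = x * y.
Proof. exact: tliftE. Qed.
End Mul.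

Section Interchange.
Variables (A B C D : lmodType k).

Definition tinterchange : {linear A \ot B \ot (C \ot D) -> A \ot C \ot (B \ot D)} :=
  tassocl A C (B \ot D)
  \o tmap idfun (tassocr C B D \o tmap (tflip B C) idfun \o tassocl B C D)
  \o tassocr A B (C \ot D).

Lemma tinterchangeE a b c d :
  tinterchange (tens (tens a b) (tens c d)) =
  tens (tens a c) (tens b d).
Proof.
by rewrite /tinterchange /= tassocrE tmapE /= tassoclE tmapE tflipE tassocrE
   tassoclE.
Qed.
End Interchange.

End TensorMaps.

Notation "f \otm g" := (tmap f g) (at level 40, left associativity).

HB.mixin Record isHopf (k : fieldType) H of GRing.Algebra k H := {
  comult : {linear H -> H \ot H};
  counit : {linear H -> k^o};
  antipode : {linear H -> H};
  comultA : tassocr H H H \o (comult \otm idfun) \o comult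
            =1 (idfun \otm comult) \o comult;
  counitl : tunitl H \o (counit \otm idfun) \o comult =1 idfun;
  counitr : tunitr H \o (idfun \otm counit) \o comult =1 idfun;
  comult1 : comult 1 = tens 1 1;
  comultM : comult \o tmul H
            =1 (tmul H \otm tmul H) \o tinterchange H H H H
               \o (comult \otm comult);
  counit1 : counit 1 = 1;
  counitM : forall x y : H, counit (x * y) = (counit x : k) * counit y;
  antipodel : forall x : H,
    tmul H ((antipode \otm idfun) (comult x)) = (counit x : k)%:A;
  antipoder : forall x : H,
    tmul H ((idfun \otm antipode) (comult x)) = (counit x : k)%:A
}.

#[short(type="hopfAlgType")]
HB.structure Definition Hopf (k : fieldType) :=
  { H of GRing.Algebra k H & isHopf k H }.

Section Comodules.
Variables (k : fieldType) (H : hopfAlgType k).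

Local Notation Delta := (@comult k H).
Local Notation eps := (@counit k H).
Local Notation S := (@antipode k H).
Local Notation mu := (tmul H).

Record is_comodule (Y : lmodType k) (d : {linear Y -> Y \ot H}) : Prop := {
  comodule_counit : tunitr Y \o (idfun \otm eps) \o d =1 idfun;
  comodule_coassoc :
    tassocr Y H H \o (d \otm idfun) \o d =1 (idfun \otm Delta) \o d
}.

Definition colinear (Z Y : lmodType k) (dZ : {linear Z -> Z \ot H})
    (dY : {linear Y -> Y \ot H}) (f : {linear Z -> Y}) : Prop :=
  dY \o f =1 (f \otm idfun) \o dZ.

(* The reassociations tassocl and tassocr are implicit in the usual notation. *)
Record is_partial_comodule (M : lmodType k) (d : {linear M -> M \ot H}) : Prop := {
  pcomodule_counit : tunitr M \o (idfun \otm eps) \o d =1 idfun;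
  pcomodule_right :
    (idfun \otm mu) \o tassocr (M \ot H) H H \o (idfun \otm S \otm idfun)
      \o (tassocl M H H \otm idfun) \o (idfun \otm Delta \otm idfun)
      \o (d \otm idfun) \o d
    =1
    (idfun \otm mu) \o tassocr (M \ot H) H H \o (idfun \otm S \otm idfun)
      \o (d \otm idfun \otm idfun) \o (d \otm idfun) \o d;
  pcomodule_left :
    (idfun \otm mu \otm idfun) \o (tassocr M H H \otm idfun)
      \o (idfun \otm S \otm idfun \otm idfun)
      \o tassocl (M \ot H) H H \o (idfun \otm Delta)
      \o (d \otm idfun) \o d
    =1
    (idfun \otm mu \otm idfun) \o (tassocr M H H \otm idfun)
      \o (idfun \otm S \otm idfun \otm idfun)
      \o (d \otm idfun \otm idfun) \o (d \otm idfun) \o d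
}.

(* The data (X, X . H, pi, rho) underlying a geometric partial comodule; in
   Vect, pi being an epimorphism means that it is surjective.                *)
Record geometric_datum := GeometricDatum {
  gd_space : lmodType k;
  gd_bullet : lmodType k;
  gd_pi : {linear gd_space \ot H -> gd_bullet};
  gd_rho : {linear gd_space -> gd_bullet};
  gd_pi_surj : forall y, exists x, gd_pi x = y
}.

Definition is_pushout (A B C P : lmodType k) (f : {linear A -> B})
    (g : {linear A -> C}) (i : {linear B -> P}) (j : {linear C -> P}) : Prop :=
  i \o f =1 j \o g /\
  forall (W : lmodType k) (u : {linear B -> W}) (v : {linear C -> W}),
    u \o f =1 v \o g ->
    exists t : {linear P -> W},
      [/\ t \o i =1 u, t \o j =1 v &
         forall t' : {linear P -> W}, t' \o i =1 u -> t' \o j =1 v -> t' =1 t].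

(* Morphisms from a global comodule (Z, d) to a geometric partial comodule.   *)
Definition partial_morphism (X : geometric_datum) (Z : lmodType k)
    (d : {linear Z -> Z \ot H}) (f : {linear Z -> gd_space X}) : Prop :=
  gd_rho X \o f =1 gd_pi X \o (f \otm idfun) \o d.

Record is_globalization (X : geometric_datum) (Y : lmodType k)
    (d : {linear Y -> Y \ot H}) (p : {linear Y -> gd_space X}) : Prop := {
  globalization_comodule : is_comodule d;
  globalization_morphism : partial_morphism d p;
  globalization_universal :
    forall (Z : lmodType k) (dZ : {linear Z -> Z \ot H}), is_comodule dZ ->
    [/\ forall eta : {linear Z -> Y},
           colinear dZ d eta -> partial_morphism dZ (p \o eta),
        forall eta1 eta2 : {linear Z -> Y},
           colinear dZ d eta1 -> colinear dZ d eta2 ->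
           p \o eta1 =1 p \o eta2 -> eta1 =1 eta2 &
        forall f : {linear Z -> gd_space X}, partial_morphism dZ f ->
           exists2 eta : {linear Z -> Y}, colinear dZ d eta & p \o eta =1 f];
  globalization_pushout :
    is_pushout p ((p \otm idfun) \o d) (gd_rho X) (gd_pi X)
}.

Definition globalizable (X : geometric_datum) : Prop :=
  exists (Y : lmodType k) (d : {linear Y -> Y \ot H})
    (p : {linear Y -> gd_space X}), is_globalization d p.

Section Associated.
Variables (M : lmodType k) (d : {linear M -> M \ot H}).
Variables (I L : choiceType) (h : I -> H) (m : L -> M).

(* a i and b l are the finitely supported coefficient families in
     Delta (h i) = sum_(j, j') (a i)@_(j, j') h_j (x) h_j'
     d (m l)     = sum_(p, j)  (b l)@_(p, j)  m_p (x) h_j                    *)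
Definition comult_coefficients (a : I -> {malg k[(I * I)%type]}) : Prop :=
  forall i, Delta (h i) = lincomb (fun jj => tens (h jj.1) (h jj.2)) (a i).

Definition coaction_coefficients (b : L -> {malg k[(L * I)%type]}) : Prop :=
  forall l, d (m l) = lincomb (fun pj => tens (m pj.1) (h pj.2)) (b l).

Variables (a : I -> {malg k[(I * I)%type]}) (b : L -> {malg k[(L * I)%type]}).

Definition bullet_relations : set (M \ot H) :=
  [set w | exists l t,
     w = \sum_(pt <- msupp (b l) | pt.2 == t)
           \sum_(qj <- msupp (b pt.1))
              ((b l)@_pt * (b pt.1)@_qj) *: tens (m qj.1) (h qj.2)
       - \sum_(qp <- msupp (b l))
           \sum_(jt <- msupp (a qp.2) | jt.2 == t)
              ((b l)@_qp * (a qp.2)@_jt) *: tens (m qp.1) (h jt.1)].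

Definition associated_datum : geometric_datum :=
  @GeometricDatum M (quotmod bullet_relations) (qproj bullet_relations)
    (qproj bullet_relations \o d) (@qproj_surj _ _ bullet_relations).

End Associated.

End Comodules.

(* Main.v *)
Require Import Defs.
From HB Require Import structures.
From mathcomp Require Import all_boot all_algebra.
From mathcomp Require Import finmap boolp classical_sets.
From mathcomp.multinomials Require Import monalg.

Set Implicit Arguments.
Unset Strict Implicit.
Unset Printing Implicit Defensive.

Import GRing.Theory.
Local Open Scope ring_scope.

(** For a vector space X, the space X \ot H with cofree X = X \ot Delta is the
    cofree comodule on X, and f \ot H is colinear between cofree comodules for
    every linear f.  Globalizing (M, B, pi, pi \o d) amounts to cutting out of
    the cofree comodule M \ot H the part on which the partial coaction d agrees
    with the cofree one up to pi:

      Y = { w | (pi \ot H) ((d \ot H) w - (M \ot Delta) w) = 0 },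

    with p the restriction of M \ot eps.  The map defining Y is colinear from
    the cofree comodule on M to the cofree comodule on B (obstruction_cofree),
    and tensoring with H preserves kernels (tmap_kernel), so Y is a subcomodule.
    A linear f : Z -> M from a comodule corresponds to the colinear map
    (f \ot H) \o dZ into the cofree comodule, and it is a partial morphism
    exactly when that map lands in Y: this is the universal property.

    The map (p \ot H) \o delta is the inclusion of Y, so the pushout condition
    compares M and M \ot H along Y.  It holds as soon as (globalizable_of_kernel)

    - d takes its values in Y, so that a cocone (u, v) satisfies u = v \o d;
    - the kernel of pi lies in Y and is killed by M \ot eps, so that v factors
      through pi.

    For the associated datum, the relations spanning Q = ker pi are the slices,
    along the dual basis of h, of the elements

      D (m_l),   D = (d \ot H) \o d - (M \ot Delta) \o d

    (bullet_relationE).  Hence (pi \ot H) \o D = 0, which is the first item.  For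
    the second, apply to D the colinear map K defining Y, tensored with H:
    (K \ot H) (d \ot H) d vanishes because K \o d does, and
    (K \ot H) (M \ot Delta) d equals (B \ot Delta) K d, which vanishes for the
    same reason (obstruction_defect).  Slicing, K kills every relation.  Finally
    M \ot eps kills them because both terms of D become d under
    M \ot eps \ot H (counit_defect). *)

(** * Kernels as vector spaces *)

Section Kernel.
Variables (k : fieldType) (V W : lmodType k) (f : {linear V -> W}).

Definition in_kernel : {pred V} := fun v => f v == 0.

Lemma in_kernel_submod_closed : submod_closed in_kernel.
Proof.
split=> [|x u v]; rewrite !unfold_in ?linear0 //.
by move=> /eqP fu /eqP fv; rewrite linearP fu fv scaler0 addr0.
Qed.
HB.instance Definition _ :=
  GRing.isSubmodClosed.Build k V in_kernel in_kernel_submod_closed.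

Lemma in_kernel_oppr_closed : oppr_closed in_kernel.
Proof. by move=> v; rewrite -scaleN1r; exact: rpredZ. Qed.
HB.instance Definition _ :=
  GRing.isOppClosed.Build V in_kernel in_kernel_oppr_closed.

(** The objects of the globalization problem are types, so the kernel has to be
    a vector space of its own, and not merely a predicate on V. *)
Record kernel := Kernel { kernel_val : V; _ : kernel_val \in in_kernel }.
HB.instance Definition _ := [isSub for kernel_val].
HB.instance Definition _ := [Choice of kernel by <:].
HB.instance Definition _ := [SubChoice_isSubLmodule of kernel by <:].

Definition kernel_incl : {linear kernel -> V} := \val.

Lemma kernel_inclK y : f (kernel_incl y) = 0.
Proof. exact/eqP/(valP y). Qed.

Lemma kernel_incl_inj : injective kernel_incl.
Proof. exact: val_inj. Qed.

Lemma kernel_incl_onto v : f v = 0 -> exists y, kernel_incl y = v.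
Proof. by move/eqP=> fv; exists (Kernel fv). Qed.
End Kernel.

(** The lift is chosen pointwise; injectivity of i makes the choice unique and
    therefore linear. *)
Lemma linear_lift (k : fieldType) (X Y Z : lmodType k) (i : {linear Y -> X})
    (T : {linear Z -> X}) :
  injective i -> (forall z, exists y, i y = T z) ->
  exists g : {linear Z -> Y}, forall z, i (g z) = T z.
Proof.
move=> i_inj /choice[g gE].
have g_lin : linear g by move=> x u v; apply: i_inj; rewrite linearP !gE linearP.
pose gM := GRing.isLinear.Build k Z Y _ g g_lin.
pose G : {linear Z -> Y} := HB.pack g gM.
by exists G.
Qed.

(** * Functoriality of the tensor product *)

Section TensorMapTheory.
Variable k : fieldType.
Implicit Types A B C D : lmodType k.

Lemma tmap_id A B (t : A \ot B) : (idfun \otm idfun) t = t.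
Proof.
apply: (tens_ext (f := idfun \otm idfun) (g := idfun)) => a b.
by rewrite tmapE.
Qed.

Lemma tmap_comp A B A' B' A'' B'' (f : {linear A -> A'}) (g : {linear B -> B'})
    (f' : {linear A' -> A''}) (g' : {linear B' -> B''}) t :
  (f' \otm g') ((f \otm g) t) = ((f' \o f) \otm (g' \o g)) t.
Proof.
apply: (tens_ext (f := (f' \otm g') \o (f \otm g))
                 (g := (f' \o f) \otm (g' \o g))) => a b.
by rewrite /= !tmapE.
Qed.

Lemma eq_tmap A B C D (f f' : {linear A -> C}) (g g' : {linear B -> D}) :
  f =1 f' -> g =1 g' -> f \otm g =1 f' \otm g'.
Proof. by move=> ff gg; apply: tens_ext => a b; rewrite !tmapE ff gg. Qed.

Lemma tmapBl A B C (f g u : {linear A -> C}) (t : A \ot B) :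
  (forall a, u a = f a - g a) ->
  (u \otm idfun) t = (f \otm idfun) t - (g \otm idfun) t.
Proof.
move=> uE; apply: (tens_ext (f := u \otm idfun)
  (g := (f \otm idfun) \- (g \otm idfun))) => a b.
by rewrite /= !tmapE uE linearBl.
Qed.

Lemma tmap_square A A1 A2 A' B (f : {linear A -> A1}) (f' : {linear A1 -> A'})
    (g : {linear A -> A2}) (g' : {linear A2 -> A'}) (t : A \ot B) :
  f' \o f =1 g' \o g ->
  (f' \otm idfun) ((f \otm idfun) t) = (g' \otm idfun) ((g \otm idfun) t).
Proof. by move=> fg; rewrite !tmap_comp; exact: eq_tmap. Qed.

Lemma tmap_triangle A A' A'' B (f : {linear A -> A'}) (f' : {linear A' -> A''})
    (g : {linear A -> A''}) (t : A \ot B) :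
  f' \o f =1 g -> (f' \otm idfun) ((f \otm idfun) t) = (g \otm idfun) t.
Proof. by move=> fg; rewrite !tmap_comp; exact: eq_tmap. Qed.

(** The projection modulo the span of the pure tensors vanishes on pure tensors,
    hence vanishes, by the uniqueness part of the universal property. *)
Lemma tens_sum A B (t : A \ot B) : exists n (a : 'I_n -> A) (b : 'I_n -> B),
  t = \sum_(i < n) tens (a i) (b i).
Proof.
pose G : set (A \ot B) := [set w | exists a b, w = tens a b]%classic.
have : qproj G t = qproj G 0.
  rewrite linear0; apply: (tens_ext (f := qproj G) (g := \0)) => a b /=.
  rewrite -(linear0 (qproj G)); apply/qproj_eq; rewrite subr0.
  by apply: mem_span; exists a, b.
move/qproj_eq; rewrite subr0 => /asboolP[n [c [g [/choice[a /choice[b gE]] ->]]]].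
(* The scalars of the linear combination are absorbed in the left factors. *)
exists n, (fun i => c i *: a i), b; apply: eq_bigr => i _.
by rewrite gE linearZl.
Qed.

Lemma tens_extr A B C D (f g : {linear A \ot (B \ot C) -> D}) :
  (forall a b c, f (tens a (tens b c)) = g (tens a (tens b c))) -> f =1 g.
Proof.
move=> fg; apply: tens_ext => a t; have [n [b [c ->]]] := tens_sum t.
by rewrite linear_sumr !linear_sum; apply: eq_bigr => i _; exact: fg.
Qed.

Lemma tens_extl A B C D (f g : {linear A \ot B \ot C -> D}) :
  (forall a b c, f (tens (tens a b) c) = g (tens (tens a b) c)) -> f =1 g.
Proof.
move=> fg; apply: tens_ext => t c; have [n [a [b ->]]] := tens_sum t.
by rewrite linear_sumlz !linear_sum; apply: eq_bigr => i _; exact: fg.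
Qed.

Lemma tassocrK A B C (t : A \ot B \ot C) : tassocl A B C (tassocr A B C t) = t.
Proof.
apply: (tens_extl (f := tassocl A B C \o tassocr A B C) (g := idfun)) => a b c.
by rewrite /= tassocrE tassoclE.
Qed.

Lemma tassoclK A B C (t : A \ot (B \ot C)) :
  tassocr A B C (tassocl A B C t) = t.
Proof.
apply: (tens_extr (f := tassocr A B C \o tassocl A B C) (g := idfun)) => a b c.
by rewrite /= tassoclE tassocrE.
Qed.

Lemma tassocl_natural A B C A' B' C' (f : {linear A -> A'})
    (g : {linear B -> B'}) (h : {linear C -> C'}) t :
  tassocl A' B' C' ((f \otm (g \otm h)) t) = (f \otm g \otm h) (tassocl A B C t).
Proof.
apply: (tens_extr (f := tassocl A' B' C' \o (f \otm (g \otm h)))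
                  (g := (f \otm g \otm h) \o tassocl A B C)) => a b c.
by rewrite /= !tmapE !tassoclE !tmapE.
Qed.

End TensorMapTheory.

(** * Slices along a basis and flatness *)

Section Slices.
Variables (k : fieldType) (H : lmodType k) (I : choiceType) (h : I -> H).
Hypothesis h_basis : is_basis h.
Implicit Types A B : lmodType k.

Lemma lincomb_inj : injective (lincomb h).
Proof.
move=> c c' cc'; have [e [_ uniq_e]] := h_basis (lincomb h c).
by rewrite -(uniq_e c) // (uniq_e c').
Qed.

Lemma exists_coordinates :
  exists co : {linear H -> {malg k[I]}}, forall v, lincomb h (co v) = v.
Proof.
apply: (linear_lift (T := idfun) lincomb_inj) => v.
by have [c [cv _]] := h_basis v; exists c.
Qed.

Definition coordinates : {linear H -> {malg k[I]}} :=
  projT1 (cid exists_coordinates).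

Lemma coordinatesK v : lincomb h (coordinates v) = v.
Proof. by rewrite /coordinates; case: cid. Qed.

Lemma coordinates_basis i : coordinates (h i) = << i >>.
Proof. by apply: lincomb_inj; rewrite coordinatesK lincombU. Qed.

Let dual_fun i (v : H) : k^o := (coordinates v)@_i.
Let dual_linear i : linear (dual_fun i).
Proof. by move=> x u v; rewrite /dual_fun linearP mcoeffD mcoeffZ. Qed.
HB.instance Definition _ i :=
  GRing.isLinear.Build k H k^o _ (dual_fun i) (dual_linear i).
Definition dual i : {linear H -> k^o} := dual_fun i.

Lemma dual_basis i j : dual i (h j) = (j == i)%:R.
Proof. by rewrite /dual /= /dual_fun coordinates_basis mcoeffU. Qed.
End Slices.

(** Contraction of the right factor.  Its instances are the coordinate functions
    of A \ot H along a basis of H, and A \ot eps, which the counit axioms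
    involve. *)
Definition slice (k : fieldType) (A H : lmodType k) (phi : {linear H -> k^o})
    (w : A \ot H) : A := tunitr A ((idfun \otm phi) w).
Arguments slice {k A H} phi w : simpl never.

Lemma slice_linear (k : fieldType) (A H : lmodType k) (phi : {linear H -> k^o}) :
  linear (slice (A := A) phi).
Proof. by move=> x u v; rewrite /slice !linearP. Qed.
HB.instance Definition _ (k : fieldType) (A H : lmodType k)
    (phi : {linear H -> k^o}) :=
  GRing.isLinear.Build k (A \ot H) A _ _ (@slice_linear k A H phi).

Lemma sliceE (k : fieldType) (A H : lmodType k) (phi : {linear H -> k^o})
    (a : A) (v : H) : slice phi (tens a v) = (phi v : k) *: a.
Proof. by rewrite /slice /= tmapE tunitrE. Qed.

Lemma slice_natural (k : fieldType) (A B H : lmodType k) (f : {linear A -> B})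
    (phi : {linear H -> k^o}) w :
  slice phi ((f \otm idfun) w) = f (slice phi w).
Proof.
apply: (tens_ext (f := slice phi \o (f \otm idfun)) (g := f \o slice phi)).
by move=> a v; rewrite /= tmapE !sliceE linearZ_LR.
Qed.

Section Flatness.
Variables (k : fieldType) (H : lmodType k) (I : choiceType) (h : I -> H).
Hypothesis h_basis : is_basis h.
Implicit Types A B : lmodType k.

Local Notation slice_at i := (slice (dual h_basis i)).

Lemma slice_basis_sum A (J : Type) (s : seq J) (c : J -> k) (x : J -> A)
    (f : J -> I) i :
  slice_at i (\sum_(j <- s) c j *: tens (x j) (h (f j))) =
  \sum_(j <- s | f j == i) c j *: x j.
Proof.
rewrite linear_sum [RHS]big_mkcond; apply: eq_bigr => j _.
rewrite linearZ_LR /= sliceE dual_basis.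
by case: eqP => _; rewrite ?scale1r // scale0r scaler0.
Qed.

(** A basis of H turns A \ot H into a direct sum of copies of A indexed by I, the
    i-th coordinate being the i-th slice. *)
Lemma slice_expansion A (w : A \ot H) : exists s : {fset I},
  w = \sum_(i <- s) tens (slice_at i w) (h i).
Proof.
suff [s [a ->]] : exists (s : {fset I}) (a : I -> A),
    w = \sum_(i <- s) tens (a i) (h i).
  exists s; apply: eq_big_seq => i si; congr (tens _ _).
  rewrite linear_sum (big_fsetD1 i) //= sliceE dual_basis eqxx scale1r.
  rewrite big_seq big1 ?addr0 // => j; rewrite !inE => /andP[ji _].
  by rewrite sliceE dual_basis (negPf ji) scale0r.
have [n [x [v ->]]] := tens_sum w.
pose c i := coordinates h_basis (v i).
pose s := (\bigcup_(i <- enum 'I_n) msupp (c i))%fset.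
exists s, (fun j => \sum_(i < n) (c i)@_j *: x i).
under [RHS]eq_bigr do rewrite linear_sumlz.
rewrite exchange_big /=; apply: eq_bigr => i _.
rewrite -{1}(coordinatesK h_basis (v i)) -/(c i) (@lincombEw _ _ _ _ _ s).
  rewrite linear_sumr; apply: eq_bigr => j _.
  by rewrite linearZl linearZr.
by apply: bigfcup_sup => //; rewrite mem_enum.
Qed.

Lemma slices_eq0 A (w : A \ot H) : (forall i, slice_at i w = 0) -> w = 0.
Proof.
move=> w0; have [s ->] := slice_expansion w.
by rewrite big1 // => i _; rewrite w0 linear0l.
Qed.

(** Slicing commutes with f \ot H, so injectivity is checked slice by slice. *)
Lemma tmap_inj A B (f : {linear A -> B}) :
  injective f -> injective (f \otm @idfun H).
Proof.
move=> f_inj; apply: raddf_inj => w fw0; apply: slices_eq0 => i.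
by apply: f_inj; rewrite -slice_natural fw0 !linear0.
Qed.

(** The half of flatness used for kernels: if f \ot H kills w then f kills the
    slices of w, which are the coefficients in an expansion of w. *)
Lemma tmap_kernel A B (f : {linear A -> B}) (w : A \ot H) :
  (f \otm idfun) w = 0 -> exists t, (kernel_incl f \otm idfun) t = w.
Proof.
move=> fw0; have [s ->] := slice_expansion w.
have /choice[y yE] i : exists y, kernel_incl f y = slice_at i w.
  by apply: kernel_incl_onto; rewrite -slice_natural fw0 linear0.
exists (\sum_(i <- s) tens (y i) (h i)); rewrite linear_sum.
by apply: eq_bigr => i _; rewrite tmapE yE.
Qed.

End Flatness.

(** * Cofree comodules *)

Section CofreeComodules.
Variables (k : fieldType) (H : hopfAlgType k).
Implicit Types (M X Y Z : lmodType k).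

Local Notation eps := (@counit k H).

Definition cofree X (w : X \ot H) : X \ot H \ot H :=
  tassocl X H H ((idfun \otm comult) w).
Arguments cofree {X} w : simpl never.

Lemma cofree_linear X : linear (@cofree X).
Proof. by move=> x u v; rewrite /cofree !linearP. Qed.
HB.instance Definition _ X :=
  GRing.isLinear.Build k (X \ot H) (X \ot H \ot H) _ _ (@cofree_linear X).

Lemma cofree_tens X (x : X) v :
  cofree (tens x v) = tassocl X H H (tens x (comult v)).
Proof. by rewrite /cofree tmapE. Qed.

Lemma cofree_natural X Y (f : {linear X -> Y}) w :
  cofree ((f \otm idfun) w) = (f \otm idfun \otm idfun) (cofree w).
Proof.
rewrite /cofree /= -tassocl_natural !tmap_comp; congr (tassocl _ _ _ _).
by apply: eq_tmap => // v /=; rewrite tmap_id.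
Qed.

Lemma cofree_counit X (w : X \ot H) : slice eps (cofree w) = w.
Proof.
apply: (tens_ext (f := slice eps \o @cofree X) (g := idfun)) => x v.
rewrite /= cofree_tens.
transitivity (tens x (slice eps (comult v))); last first.
  by congr (tens _ _); exact: counitr.
have [n [a [b ->]]] := tens_sum (comult v).
rewrite !linear_sum; apply: eq_bigr => i _; rewrite /=.
by rewrite tassoclE !sliceE linearZr.
Qed.

Lemma counit_cofree X (w : X \ot H) : (slice eps \otm idfun) (cofree w) = w.
Proof.
apply: (tens_ext (f := (slice eps \otm idfun) \o @cofree X) (g := idfun)).
move=> x v; rewrite /= cofree_tens.
transitivity (tens x (tunitl H ((eps \otm idfun) (comult v)))); last first.
  by congr (tens _ _); exact: counitl.
have [n [a [b ->]]] := tens_sum (comult v).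
rewrite !linear_sum; apply: eq_bigr => i _.
by rewrite tassoclE !tmapE tunitlE /= sliceE linearZl linearZr.
Qed.

Lemma cofree_coassoc X (w : X \ot H) :
  cofree (cofree w) = (@cofree X \otm idfun) (cofree w).
Proof.
apply: (tens_ext (f := @cofree _ \o @cofree X)
                 (g := (@cofree X \otm idfun) \o @cofree X)) => x v.
rewrite /= !cofree_tens.
(* Both sides are the image, with all brackets moved left, of x tensored with
   one of the two members of the coassociativity of comult. *)
pose Phi t := tassocl (X \ot H) H H (tassocl X H (H \ot H) (tens x t)).
have PhiD : {morph Phi : t u / t + u}.
  by move=> t u; rewrite /Phi linearDr !linearD.
have Phi0 : Phi 0 = 0 by rewrite /Phi linear0r !linear0.
transitivity (Phi ((idfun \otm comult) (comult v))).
  have [n [a [b ->]]] := tens_sum (comult v).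
  rewrite linear_sumr !linear_sum (big_morph Phi PhiD Phi0).
  apply: eq_bigr => i _.
  by rewrite tassoclE /Phi !tmapE /= cofree_tens tassoclE.
rewrite -[_ (comult v)]comultA /=.
have [n [a [b ->]]] := tens_sum (comult v).
rewrite linear_sumr !linear_sum (big_morph Phi PhiD Phi0).
apply: eq_bigr => i _; rewrite tassoclE !tmapE /= cofree_tens.
have [m [c [e ->]]] := tens_sum (comult (a i)).
rewrite linear_sumr linear_sum !linear_sumlz linear_sum (big_morph Phi PhiD Phi0).
by apply: eq_bigr => j _; rewrite /Phi tassocrE !tassoclE.
Qed.

(** The comodule identities for d hold after composition with i, i \ot H or
    i \ot H \ot H, all of which are injective. *)
Lemma subcomodule (I : choiceType) (h : I -> H) X Y (c : {linear X -> X \ot H})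
    (i : {linear Y -> X}) (d : {linear Y -> Y \ot H}) :
  is_basis h -> injective i -> (forall y, (i \otm idfun) (d y) = c (i y)) ->
  is_comodule c -> is_comodule d.
Proof.
move=> h_basis i_inj idE [c_counit c_coassoc]; split=> y /=.
  apply: i_inj; rewrite -[LHS](slice_natural i eps) idE; exact: c_counit.
apply: (can_inj (@tassoclK _ _ _ _)); rewrite tassocrK -[RHS]/(cofree (d y)).
apply: (tmap_inj h_basis (tmap_inj h_basis i_inj)).
rewrite -cofree_natural (tmap_square (g := i) (g' := c)) // idE.
by rewrite -[LHS]tassocrK [X in tassocl _ _ _ X](c_coassoc (i y)).
Qed.

Lemma cofree_comodule X : is_comodule (@cofree X).
Proof.
split=> w /=; first exact: cofree_counit.
by rewrite -cofree_coassoc /cofree tassoclK.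
Qed.
End CofreeComodules.

(** * The globalization inside the cofree comodule *)

Section Globalization.
Variables (k : fieldType) (H : hopfAlgType k) (M B : lmodType k).
Variables (d : {linear M -> M \ot H}) (pi : {linear M \ot H -> B}).
Hypothesis pi_surj : forall y, exists x, pi x = y.

Local Notation eps := (@counit k H).

Hypothesis d_counit : forall x, slice eps (d x) = x.

(** Its composite with d measures the failure of d to be coassociative. *)
Definition defect (w : M \ot H) : M \ot H \ot H := (d \otm idfun) w - cofree w.
Arguments defect w : simpl never.

Lemma defect_linear : linear defect.
Proof. by move=> c u v; rewrite -[defect]/(_ \- _) linearP. Qed.
HB.instance Definition _ :=
  GRing.isLinear.Build k (M \ot H) (M \ot H \ot H) _ defect defect_linear.

(** The equalizer of (pi \o d) \ot H and (pi \ot H) \o (M \ot Delta), in the form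
    of a kernel: the space cut out is the carrier of the globalization. *)
Definition obstruction (w : M \ot H) : B \ot H := (pi \otm idfun) (defect w).
Arguments obstruction w : simpl never.

Lemma obstruction_linear : linear obstruction.
Proof. by move=> c u v; rewrite /obstruction !linearP. Qed.
HB.instance Definition _ :=
  GRing.isLinear.Build k (M \ot H) (B \ot H) _ obstruction obstruction_linear.

(** Colinearity of a difference of colinear maps: d \ot H is colinear by
    naturality of cofree, and cofree itself by coassociativity. *)
Lemma defect_cofree w : (defect \otm idfun) (cofree w) = cofree (defect w).
Proof.
rewrite (@tmapBl _ _ _ _ (d \otm idfun) (@cofree k H M)) //.
by rewrite -cofree_natural -cofree_coassoc -linearB.
Qed.

Lemma obstruction_cofree w :
  (obstruction \otm idfun) (cofree w) = cofree (obstruction w).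
Proof.
rewrite cofree_natural -defect_cofree.
by rewrite (tmap_triangle (g := obstruction)).
Qed.

(** M \ot eps \ot H retracts both d \ot H and M \ot Delta. *)
Lemma counit_defect w : (slice eps \otm idfun) (defect w) = 0.
Proof.
rewrite /defect linearB /= counit_cofree.
by rewrite (tmap_triangle (g := idfun)) ?tmap_id ?subrr.
Qed.

Hypothesis d_equalized : forall x, obstruction (d x) = 0.

(** Colinearity of the obstruction moves it past M \ot Delta, so that in both
    terms of the defect it gets applied to a value of d. *)
Lemma obstruction_defect x : (obstruction \otm idfun) (defect (d x)) = 0.
Proof.
rewrite /defect linearB /= obstruction_cofree d_equalized linear0 subr0.
rewrite (tmap_triangle (g := \0)) //.
apply: (tens_ext (f := \0 \otm idfun) (g := \0)) => a b.
by rewrite tmapE linear0l.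
Qed.

Hypothesis pi_kernel :
  forall w, pi w = 0 -> obstruction w = 0 /\ slice eps w = 0.

Variables (I : choiceType) (h : I -> H).
Hypothesis h_basis : is_basis h.

(** Injectivity of the inclusion i of the kernel, and of i \ot H, transports
    every verification into the cofree comodule on M. *)
Theorem globalizable_of_kernel :
  globalizable (@GeometricDatum k H M B pi (pi \o d) pi_surj).
Proof.
pose Y := kernel obstruction.
pose i : {linear Y -> _} := kernel_incl obstruction.
have i_inj : injective i := @kernel_incl_inj _ _ _ _.
have iH_inj := tmap_inj h_basis i_inj.
have [delta deltaE] : exists delta : {linear Y -> Y \ot H},
    forall y, (i \otm idfun) (delta y) = cofree (i y).
  apply: (linear_lift (T := @cofree k H M \o i) iH_inj) => y.
  apply: (tmap_kernel h_basis).
  by rewrite /= obstruction_cofree kernel_inclK linear0.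
pose p : {linear Y -> M} := slice eps \o i.
have pdelta y : (p \otm idfun) (delta y) = i y.
  by rewrite -(tmap_triangle (f := i) (f' := slice eps)) // deltaE counit_cofree.
(* On Y the defect is zero modulo pi; contracting its last factor with eps
   leaves d (p y) - i y. *)
have rho_p y : pi (d (p y)) = pi (i y).
  have := slice_natural pi eps (defect (i y)).
  rewrite -[_ (defect (i y))]/(obstruction (i y)) kernel_inclK linear0.
  rewrite /defect !linearB /= slice_natural cofree_counit.
  by move/eqP; rewrite eq_sym subr_eq0 => /eqP.
exists Y, delta, p; split.
- exact: (subcomodule h_basis i_inj deltaE (cofree_comodule H M)).
- by move=> y /=; rewrite pdelta rho_p.
- move=> Z dZ [Z_counit Z_coassoc].
  (* A colinear map into Y is determined by its composite with p, as for a
     cofree comodule. *)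
  have recover (eta : {linear Z -> Y}) : colinear dZ delta eta ->
      forall z, ((p \o eta) \otm idfun) (dZ z) = i (eta z).
    move=> eta_col z; rewrite -pdelta [delta _]eta_col /=.
    by rewrite (tmap_triangle (g := p \o eta)).
  split.
  + by move=> eta eta_col z /=; rewrite rho_p recover.
  + move=> e1 e2 e1_col e2_col e12 z; apply: i_inj.
    by rewrite -!recover //; exact: eq_tmap.
  + (* The colinear map into the cofree comodule that corresponds to f. *)
    move=> f f_mor; pose T : {linear Z -> _} := (f \otm idfun) \o dZ.
    have TE z : cofree (T z) = (T \otm idfun) (dZ z).
      rewrite /T /= cofree_natural.
      rewrite -(tmap_triangle (f := dZ) (f' := f \otm idfun)) //.
      by congr (_ _); rewrite -[RHS]tassocrK [X in tassocl _ _ _ X]Z_coassoc.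
    have T0 z : exists y, i y = T z.
      apply: kernel_incl_onto; rewrite -[LHS]/(obstruction (T z)).
      rewrite /obstruction /defect TE linearB /= !tmap_comp.
      by apply/eqP; rewrite subr_eq0; apply/eqP/eq_tmap => //= x; exact: f_mor.
    have [eta etaE] := linear_lift i_inj T0; exists eta.
      move=> z /=; apply: iH_inj; rewrite deltaE etaE TE.
      by rewrite (tmap_triangle (g := T)).
    move=> z; rewrite -[LHS]/(slice eps (i (eta z))) etaE /T /= slice_natural.
    by congr (f _); exact: Z_counit.
- split=> [y|W u v uv] /=; first by rewrite pdelta rho_p.
  have uvE y : u (p y) = v (i y) by rewrite -[LHS]/((u \o p) y) uv /= pdelta.
  have u_d x : v (d x) = u x.
    have [y yE] : exists y, i y = d x by exact: kernel_incl_onto.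
    by rewrite -yE -uvE -[p y]/(slice eps (i y)) yE d_counit.
  have v_pi w w' : pi w = pi w' -> v w = v w'.
    move=> ww'; apply/eqP; rewrite -subr_eq0 -linearB.
    have /pi_kernel[/kernel_incl_onto[y yE] eps0] : pi (w - w') = 0.
      by rewrite linearB ww' subrr.
    by rewrite -yE -uvE -[p y]/(slice eps (i y)) yE eps0 linear0.
  have /choice[s sE] := pi_surj.
  have t_lin : linear (v \o s).
    move=> c x y /=; rewrite -linearP; apply: v_pi.
    by rewrite linearP !sE.
  pose tM := GRing.isLinear.Build k B W _ _ t_lin.
  pose t : {linear B -> W} := HB.pack (v \o s) tM.
  have tE w : t (pi w) = v w by apply: v_pi; rewrite sE.
  exists t; split=> [x|w|t' _ t'E q].
  - exact: etrans (tE _) (u_d x).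
  - exact: tE.
  - by have [w <-] := pi_surj q; rewrite tE; exact: t'E.
Qed.
End Globalization.

(** * The relations of the associated datum *)

(** Expanding D (m_l) in the bases, the t-th slice keeps the terms whose last
    factor is h_t: the generators of Q are the slices of D. *)
Lemma bullet_relationE (k : fieldType) (H : hopfAlgType k)
    (M : lmodType k) (d : {linear M -> M \ot H})
    (I L : choiceType) (h : I -> H) (m : L -> M) (h_basis : is_basis h)
    (a : I -> {malg k[(I * I)%type]}) (b : L -> {malg k[(L * I)%type]})
    (a_coef : comult_coefficients h a)
    (b_coef : coaction_coefficients d h m b) l t :
  slice (dual h_basis t) (defect d (d (m l))) =
    \sum_(pt <- msupp (b l) | pt.2 == t)
      \sum_(qj <- msupp (b pt.1))
        ((b l)@_pt * (b pt.1)@_qj) *: tens (m qj.1) (h qj.2)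
    - \sum_(qp <- msupp (b l))
        \sum_(jt <- msupp (a qp.2) | jt.2 == t)
          ((b l)@_qp * (a qp.2)@_jt) *: tens (m qp.1) (h jt.1).
Proof.
rewrite /defect linearB /= slice_natural; congr (_ - _); rewrite b_coef /lincomb.
  rewrite slice_basis_sum linear_sum; apply: eq_bigr => -[p j] _ /=.
  rewrite linearZ_LR /= b_coef /lincomb scaler_sumr.
  by apply: eq_bigr => qj _; rewrite scalerA.
rewrite !linear_sum; apply: eq_bigr => -[q p] _ /=.
rewrite linearZ_LR /= cofree_tens a_coef /lincomb linear_sumr linear_sum.
rewrite (eq_bigr (fun jt => (a p)@_jt *: tens (tens (m q) (h jt.1)) (h jt.2)));
  last by move=> jt _; rewrite linearZr_LR linearZ_LR /= tassoclE.
rewrite linearZ_LR /= slice_basis_sum scaler_sumr.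
by apply: eq_bigr => jt _; rewrite scalerA.
Qed.

Theorem theorem3p21 (k : fieldType) (H : hopfAlgType k)
    (M : lmodType k) (d : {linear M -> M \ot H})
    (partial_M : is_partial_comodule d)
    (I L : choiceType) (h : I -> H) (m : L -> M)
    (h_basis : is_basis h) (m_basis : is_basis m)
    (a : I -> {malg k[(I * I)%type]}) (b : L -> {malg k[(L * I)%type]})
    (a_coef : comult_coefficients h a) (b_coef : coaction_coefficients d h m b) :
  globalizable (associated_datum d h m a b).
Proof.
have d_counit x : slice (@counit k H) (d x) = x := pcomodule_counit partial_M x.
pose Q := bullet_relations h m a b.
have relE l t := bullet_relationE h_basis a_coef b_coef l t.
have d_equalized x : obstruction d (qproj Q) (d x) = 0.
  (* The slices of D x are combinations of relations, hence die under pi. *)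
  apply: (slices_eq0 (h_basis := h_basis) (A := quotmod Q)) => t.
  rewrite /obstruction slice_natural.
  pose f : {linear M -> quotmod Q} :=
    qproj Q \o slice (dual h_basis t) \o defect d \o d.
  have f0 l : f (m l) = 0.
    rewrite -(linear0 (qproj Q)); apply/qproj_eq; rewrite subr0 /= relE.
    by apply: mem_span; exists l, t.
  have [c [-> _]] := m_basis x; rewrite -[LHS]/(f _) linear_sum big1 // => l _.
  by rewrite linearZ_LR f0 scaler0.
apply: (globalizable_of_kernel (@qproj_surj _ _ Q) d_counit d_equalized _ h_basis).
move=> w; rewrite -[X in _ = X](linear0 (qproj Q)) => /qproj_eq.
rewrite subr0 => /asboolP[n [c [g [Qg ->]]]].
have gE j : exists l t, g j = slice (dual h_basis t) (defect d (d (m l))).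
  by have [l [t ->]] := Qg j; exists l, t; rewrite relE.
rewrite !linear_sum; split; apply: big1 => j _; have [l [t ->]] := gE j.
  rewrite linearZ_LR /= -[X in _ *: X](slice_natural (obstruction d (qproj Q))).
  by rewrite obstruction_defect // linear0 scaler0.
rewrite linearZ_LR /= -[X in _ *: X](slice_natural (slice counit)).
by rewrite counit_defect // linear0 scaler0.
Qed.
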